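(* Let $n\ge 2$ be an integer and let $A$ satisfy $0,n-1\in A\subset\{0,1,\dots,n-1\}$. If $\#A<\sqrt{n}$, then $A$ is not $n$-good.
   Context: For an integer $n\ge 2$ and a set $A$ of integers with $0,n-1\in A\subset\{0,1,\dots,n-1\}$, $C_A=C_{A,n}=\left\{\sum_{i=1}^\infty a_i n^{-i} : a_i\in A\right\}$, which is the attractor of the iterated function system $\{x\mapsto (x+a)/n : a\in A\}$. The sign $+$ between sets denotes the Minkowski sum. The set $A$ is called $n$-good if $0,n-1\in A\subset\{0,1,\dots,n-1\}$ and $C_A+C_A=[0,2]$. $\#A$ denotes the cardinality of $A$. *)

(* Defs.v *)
From HB Require Import structures.
From mathcomp Require Import all_boot all_order all_algebra finmap.
From mathcomp Require Import all_classical all_reals all_analysis.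

Set Implicit Arguments.
Unset Strict Implicit.
Unset Printing Implicit Defensive.

Import Order.TTheory GRing.Theory Num.Theory.
Import numFieldNormedType.Exports.

Local Open Scope classical_set_scope.
Local Open Scope ring_scope.

Definition digit_set (n : nat) (A : {fset int}) : Prop :=
  [/\ 0 \in A, n%:Z - 1 \in A & forall a, a \in A -> 0 <= a <= n%:Z - 1].

(* Sequences are indexed from 0, so [a i] is the digit of weight n^-(i+1). *)
Definition cantor_set (R : realType) (n : nat) (A : {fset int}) : set R :=
  [set x | exists a : nat -> int, (forall i, a i \in A) /\
     series (fun i => (a i)%:~R * n%:R ^- i.+1 : R) @ \oo --> x].
Arguments cantor_set : clear implicits.

Definition minkowski_sum (R : realType) (X Y : set R) : set R :=
  [set x + y | x in X & y in Y].

Definition n_good (R : realType) (n : nat) (A : {fset int}) : Prop :=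
  digit_set n A /\
  minkowski_sum (cantor_set R n A) (cantor_set R n A) = `[0, 2]%classic.
Arguments n_good : clear implicits.

(* Main.v *)
Require Import Defs.
From mathcomp Require Import all_boot all_order all_algebra finmap.
From mathcomp Require Import all_classical all_reals all_analysis.
From mathcomp Require Import zify lra.

Import Order.TTheory GRing.Theory Num.Theory.
Import numFieldNormedType.Exports.

Local Open Scope fset_scope.
Local Open Scope ring_scope.

(** The first-level cylinders already decide the matter.  A point of [C_A] with
    first digit [a] lies in [[a/n, (a+1)/n]] ([cantor_set_first_digit]), so
    [C_A + C_A] is covered by the intervals [[s/n, (s+2)/n]] with [s] in
    [A + A].  There are at most [#A ^ 2 < n] of them, each of length [2/n]:
    their total length is less than [2], and they cannot cover [[0, 2]].

    In the proof, the length comparison is replaced by a pigeonhole argument on the [n]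
    test points [(2j + 1/2)/n], [0 <= j < n].  The interval of [s] contains the
    [j]-th of them only if [s] is [2j - 1] or [2j], so that [s] determines [j].
    Thus covering all the test points requires [n] distinct sums, hence [n]
    distinct pairs of digits ([leq_card_sqr_of_cover]). *)

(** The remaining room [n ^- N.+1] below the right endpoint is what makes the
    induction go through: a further digit uses up at most
    [(n - 1) / n ^ N.+2 = n ^- N.+1 - n ^- N.+2] of it. *)
Lemma digit_series_bounds (R : realType) (n : nat) (a : nat -> int) (N : nat) :
  (0 < n)%N -> (forall i, 0 <= a i <= n%:Z - 1) ->
  (a 0%N)%:~R / n%:R
    <= series (fun i => (a i)%:~R * n%:R ^- i.+1 : R) N.+1
    <= ((a 0%N)%:~R + 1) / n%:R - n%:R ^- N.+1.
Proof.
move=> n_gt0 a_digit.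
have n_neq0 : (n%:R : R) != 0 by rewrite pnatr_eq0 -lt0n.
elim: N => [|N /andP[IHl IHu]].
  by rewrite /series /= big_nat1 expr1 mulrDl mul1r addrK lexx.
set u := fun i => _ in IHl IHu *.
have -> : series u N.+2 = series u N.+1 + u N.+1.
  by rewrite /series /= big_nat_recr.
have weight_ge0 : 0 <= (n%:R : R) ^- N.+2 by rewrite invr_ge0 exprn_ge0.
have weightE : (n%:R : R) ^- N.+1 = n%:R * n%:R ^- N.+2.
  by rewrite [in RHS]exprS invfM mulrA divff // mul1r.
have /andP[a_ge0 a_le] := a_digit N.+1.
have aR_ge0 : 0 <= (a N.+1)%:~R :> R by rewrite ler0z.
have aR_le : (a N.+1)%:~R <= n%:R - 1 :> R.
  by move: a_le; rewrite -(ler_int R) rmorphB.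
have term_ge0 : 0 <= u N.+1 by rewrite mulr_ge0.
have term_le : u N.+1 <= (n%:R - 1) * n%:R ^- N.+2 by rewrite ler_wpM2r.
rewrite weightE in IHu; rewrite mulrBl mul1r in term_le.
apply/andP; split; lra.
Qed.

Lemma cantor_set_first_digit (R : realType) (n : nat) (A : {fset int}) (x : R) :
  (0 < n)%N -> digit_set n A -> cantor_set R n A x ->
  exists2 a, a \in A & a%:~R <= n%:R * x <= a%:~R + 1.
Proof.
move=> n_gt0 [_ _ A_digit] [a [aA cvg_x]]; exists (a 0%N) => //.
set u := series _ in cvg_x.
have nR_gt0 : (0 : R) < n%:R by rewrite ltr0n.
have bounds N := @digit_series_bounds R n a N n_gt0 (fun i => A_digit _ (aA i)).
have cvg_u : cvgn u by apply/cvg_ex; exists x.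
have limE : limn u = x by apply/cvg_lim.
have x_ge : (a 0%N)%:~R / n%:R <= x.
  rewrite -limE; apply: limr_ge => //; exists 1%N => // -[|N] // _.
  by case/andP: (bounds N).
have x_le : x <= ((a 0%N)%:~R + 1) / n%:R.
  rewrite -limE; apply: limr_le => //; exists 1%N => // -[|N] // _.
  case/andP: (bounds N) => _ /le_trans; apply.
  by rewrite gerBl invr_ge0 exprn_ge0.
by rewrite mulrC -ler_pdivrMr // x_ge -ler_pdivlMr.
Qed.

(** The sets [{2j - 1, 2j}] are pairwise disjoint, so a choice of one pair of
    elements for each [j] is injective. *)
Lemma leq_card_sqr_of_cover (n : nat) (A : {fset int}) :
  (forall j : 'I_n, exists p : A * A,
     2 * j%:Z - 1 <= val p.1 + val p.2 <= 2 * j%:Z) ->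
  (n <= #|` A| ^ 2)%N.
Proof.
move=> /choice[f f_sum].
have f_inj : injective f.
  by move=> i j fij; apply: val_inj; have := f_sum i; have := f_sum j;
     rewrite fij /=; lia.
by have := leq_card f f_inj; rewrite card_ord card_prod -cardfE mulnn.
Qed.

Theorem theorem2p1 (R : realType) (n : nat) (A : {fset int}) :
  (2 <= n)%N ->
  digit_set n A ->
  (#|` A|)%:R < Num.sqrt (n%:R : R) ->
  ~ n_good R n A.
Proof.
move=> n_ge2 A_digit card_lt [_ sumE].
have n_gt0 : (0 < n)%N by exact: ltnW.
have nR_gt0 : (0 : R) < n%:R by rewrite ltr0n.
have sqr_lt : (#|` A| ^ 2 < n)%N.
  rewrite -(ltr_nat R) natrX -[ltRHS]sqr_sqrtr ?ler0n //.
  by rewrite ltrXn2r // ?nnegrE ?sqrtr_ge0.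
suff : (n <= #|` A| ^ 2)%N by rewrite leqNgt sqr_lt.
apply: leq_card_sqr_of_cover => j.
set t : R := (2 * j%:R + 2^-1) / n%:R.
have ntE : n%:R * t = 2 * j%:R + 2^-1 by rewrite mulrC divfK ?gt_eqF.
have jR_ge0 : (0 : R) <= j%:R by [].
have jR_le : (j%:R : R) + 1 <= n%:R by rewrite natr1 ler_nat.
have : `[0, 2]%classic t.
  rewrite /= in_itv /= divr_ge0 ?ler_pdivrMr //; lra.
rewrite -sumE => -[x /(cantor_set_first_digit _ _ _ _ n_gt0 A_digit)[a aA a_x]].
move=> [y /(cantor_set_first_digit _ _ _ _ n_gt0 A_digit)[b bA b_y]] xyE.
exists ([` aA], [` bA]) => /=.
rewrite -xyE mulrDr in ntE.
(* The offset [1/2] turns both non-strict real bounds into strict integer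
   bounds, which leaves only two values for [a + b]. *)
have sum_lt : a + b < 2 * j%:Z + 1.
  by rewrite -(ltr_int R) !(rmorphD, rmorphM) /=; lra.
have sum_gt : 2 * j%:Z - 2 < a + b.
  by rewrite -(ltr_int R) !(rmorphD, rmorphB, rmorphM) /=; lra.
lia.
Qed.
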